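(* Let $N\ge 1$, $\mu_1,\dots,\mu_N>0$, $\alpha>0$, $\beta>0$, $\gamma\in\mathbb{R}$, $c\ge 0$, $\lambda>0$, and $\Lambda:=\sum_{i=1}^N\mu_i$. Let $$H(q):=\sum_{i=1}^N\mu_i^{1-\beta}q_i+\frac{\lambda}{\alpha}\log\!\left(\sum_{j=1}^N\mu_j^\gamma\exp\!\left(-\alpha(q_j+c)/\mu_j^\beta\right)\right).$$ If $\lambda<\Lambda$, then $H$ is convex and coercive on $\mathbb{R}_+^N$.
   Context: Here $\mathbb{R}_+^N=[0,\infty)^N$. Coercive on $\mathbb{R}_+^N$ means $H(q)\to+\infty$ as $\|q\|_2\to\infty$ with $q\in\mathbb{R}_+^N$. *)

(* Defs.v *)
From mathcomp Require Import all_boot all_order all_algebra.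
From mathcomp Require Import all_classical all_reals all_analysis.

Set Implicit Arguments.
Unset Strict Implicit.
Unset Printing Implicit Defensive.

Import Order.TTheory GRing.Theory Num.Theory.

Local Open Scope classical_set_scope.
Local Open Scope ring_scope.

Definition nonneg_orthant (R : realType) (N : nat) : set 'rV[R]_N :=
  [set q | forall i, 0 <= q 0 i].

Arguments nonneg_orthant : clear implicits.

(* The library norm on ['rV[R]_N] is the sup norm. *)
Definition norm2 (R : realType) (N : nat) (q : 'rV[R]_N) : R :=
  Num.sqrt (\sum_(i < N) q 0 i ^+ 2).

Definition coercive_on (R : realType) (N : nat) (D : set 'rV[R]_N)
    (f : 'rV[R]_N -> R) : Prop :=
  forall A : R, exists M : R, forall q : 'rV[R]_N,
    D q -> M < norm2 q -> A < f q.

Definition H (R : realType) (N : nat) (mu : 'I_N -> R)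
    (alpha beta gamma c lambda : R) (q : 'rV[R]_N) : R :=
  \sum_(i < N) mu i `^ (1 - beta) * q 0 i
  + lambda / alpha *
    ln (\sum_(j < N)
          mu j `^ gamma * expR (- alpha * (q 0 j + c) / mu j `^ beta)).

(* Main.v *)
Require Import Defs.
From mathcomp Require Import all_boot all_order all_algebra.
From mathcomp Require Import all_classical all_reals all_analysis.
From mathcomp Require Import ring.

Import Order.TTheory GRing.Theory Num.Theory.

Local Open Scope classical_set_scope.
Local Open Scope ring_scope.

(** Both claims rest on the Gibbs (tangent plane) inequality
    [ln (\sum a) + (\sum a d) / \sum a <= ln (\sum a e^d)], a form of Jensen's
    inequality for [expR]. Taken with the weights of the log-sum-exp at a convex
    combination, it gives convexity. Taken with [a = mu], it bounds [H] below by
    [(1 - lambda / Lambda) S + K], where [S := \sum_i mu_i^(1 - beta) q_i] is the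
    linear part of [H] and [K] is a constant; [S] dominates the norm on the
    orthant. *)

(** Here [m] is the mean of [d] under the weights [a]. After factoring out [expR m], the bound
    [1 + x <= expR x] applies to each [d i - m], and these deviations have weighted sum zero. *)
Lemma ln_sum_expR_ge (R : realType) (I : finType) (a d : I -> R) :
  (forall i, 0 <= a i) -> 0 < \sum_i a i ->
  ln (\sum_i a i) + (\sum_i a i * d i) / (\sum_i a i)
  <= ln (\sum_i a i * expR (d i)).
Proof.
move=> a_ge0; set S := \sum_i a i => S_gt0; set m := _ / S.
have le_sum : S * expR m <= \sum_i a i * expR (d i).
  have -> : \sum_i a i * expR (d i) = (\sum_i a i * expR (d i - m)) * expR m.
    rewrite mulr_suml; apply: eq_bigr => i _.
    by rewrite -mulrA -expRD subrK.
  rewrite ler_wpM2r ?expR_ge0//.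
  have -> : S = \sum_i a i * (1 + (d i - m)).
    under eq_bigr do rewrite mulrDr mulr1 mulrBr.
    rewrite big_split/= sumrB -mulr_suml -/S /m [S * _]mulrC divfK ?gt_eqF//.
    by rewrite subrr addr0.
  by apply: ler_sum => i _; rewrite ler_wpM2l ?expR_ge1Dx.
have -> : ln S + m = ln (S * expR m) by rewrite lnM ?posrE ?expR_gt0// expRK.
have Sm_gt0 : 0 < S * expR m by rewrite mulr_gt0 ?expR_gt0.
by rewrite ler_ln ?posrE// (lt_le_trans Sm_gt0 le_sum).
Qed.

Lemma ln_sum_expR_convex (R : realType) (I : finType) (w u v : I -> R) (t : R) :
  (forall i, 0 < w i) -> (0 < #|I|)%N -> 0 <= t <= 1 ->
  ln (\sum_i w i * expR (t * u i + (1 - t) * v i))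
  <= t * ln (\sum_i w i * expR (u i)) + (1 - t) * ln (\sum_i w i * expR (v i)).
Proof.
move=> w_gt0 /card_gt0P[i0 _] /andP[t_ge0 t_le1].
pose z i := t * u i + (1 - t) * v i.
pose a i := w i * expR (z i).
have a_gt0 i : 0 < a i by rewrite mulr_gt0 ?expR_gt0.
have S_gt0 : 0 < \sum_i a i.
  by rewrite (bigD1 i0)//= ltr_pwDl// sumr_ge0// => i _; exact: ltW.
have tangent x : ln (\sum_i a i) + (\sum_i a i * (x i - z i)) / (\sum_i a i)
    <= ln (\sum_i w i * expR (x i)).
  have -> : \sum_i w i * expR (x i) = \sum_i a i * expR (x i - z i).
    by apply: eq_bigr => i _; rewrite /a -mulrA -expRD addrC subrK.
  by apply: ln_sum_expR_ge => // i; exact: ltW.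
(* The tangents are taken at [z], and [t * (u i - z i) + (1 - t) * (v i - z i) = 0], so the
   first-order terms cancel. *)
have balance : t * (\sum_i a i * (u i - z i))
    + (1 - t) * (\sum_i a i * (v i - z i)) = 0.
  rewrite !mulr_sumr -big_split big1//= => i _; rewrite /z; ring.
have t'_ge0 : 0 <= 1 - t by rewrite subr_ge0.
apply: le_trans (lerD (ler_wpM2l t_ge0 (tangent u))
                      (ler_wpM2l t'_ge0 (tangent v))).
rewrite le_eqVlt; apply/orP; left; apply/eqP.
rewrite !mulrDr !mulrA addrACA -!mulrDl balance; ring.
Qed.

Lemma norm2_le_sum (R : realType) (N : nat) (q : 'rV[R]_N) :
  nonneg_orthant R N q -> norm2 q <= \sum_(i < N) q 0 i.
Proof.
move=> q_ge0.
have S_ge0 : 0 <= \sum_(i < N) q 0 i by apply: sumr_ge0 => i _; exact: q_ge0.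
rewrite /norm2 -[leRHS]ger0_norm// -sqrtr_sqr ler_sqrt ?sqr_ge0//.
rewrite expr2 mulr_suml ler_sum// => i _.
rewrite expr2 ler_wpM2l ?q_ge0// (bigD1 i)//= lerDl.
by apply: sumr_ge0 => j _; exact: q_ge0.
Qed.

(** Each [q 0 i] is at most [(p i)^-1] times the whole weighted sum, since the other terms of that
    sum are nonnegative. *)
Lemma norm2_le_weighted_sum (R : realType) (N : nat) (p : 'I_N -> R)
    (q : 'rV[R]_N) :
  (forall i, 0 < p i) -> nonneg_orthant R N q ->
  norm2 q <= (\sum_(i < N) p i * q 0 i) * \sum_(i < N) (p i)^-1.
Proof.
move=> p_gt0 q_ge0; apply: le_trans (@norm2_le_sum _ _ _ q_ge0) _.
rewrite mulr_sumr ler_sum// => i _.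
rewrite ler_pdivlMr// mulrC (bigD1 i)//= lerDl.
by apply: sumr_ge0 => j _; rewrite mulr_ge0 ?q_ge0// ltW.
Qed.

Lemma H_convex (R : realType) (N : nat) (mu : 'I_N -> R)
    (alpha beta gamma c lambda : R) :
  (0 < N)%N -> (forall i, 0 < mu i) -> 0 < alpha -> 0 <= lambda ->
  convex_function (nonneg_orthant R N) (H mu alpha beta gamma c lambda).
Proof.
move=> N_gt0 mu_gt0 alpha_gt0 lambda_ge0 t x y _ _.
set s : R := t%:num.
pose w i := mu i `^ gamma.
pose e (q : 'rV[R]_N) i := - alpha * (q 0 i + c) / mu i `^ beta.
rewrite convRE -/s /unstable.onem.
(* The linear part and the exponents [e] are affine in [q], so both commute with the convex
   combination; only the log-sum-exp is left to estimate. *)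
have -> : H mu alpha beta gamma c lambda (conv t x y) =
    s * (\sum_i mu i `^ (1 - beta) * x 0 i)
    + (1 - s) * (\sum_i mu i `^ (1 - beta) * y 0 i)
    + lambda / alpha * ln (\sum_i w i * expR (s * e x i + (1 - s) * e y i)).
  rewrite /H !mulr_sumr -big_split/=; congr (_ + _ * ln _).
    by apply: eq_bigr => i _; rewrite !mxE -/s /unstable.onem; ring.
  apply: eq_bigr => i _; rewrite !mxE -/s /unstable.onem /e; congr (_ * expR _); ring.
have s01 : 0 <= s <= 1 by rewrite /s ge0 le1.
have cardN : (0 < #|'I_N|)%N by rewrite card_ord.
have := @ln_sum_expR_convex _ _ w (e x) (e y) s
  (fun i => powR_gt0 _ (mu_gt0 i)) cardN s01.
have la_ge0 : 0 <= lambda / alpha by rewrite divr_ge0// ltW.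
move=> /(ler_wpM2l la_ge0) le_lse; rewrite /H !mulrDr addrACA lerD2l.
by apply: le_trans le_lse _; rewrite mulrDr !(mulrCA (lambda / alpha)).
Qed.

(** With weights [mu i], the tangent has slope proportional to [mu i * (- alpha / mu i]^ beta) = -
    alpha * mu i [^ (1 - beta)]. This is a multiple of the linear part of [H], so the logarithm
    takes away only the fraction [lambda / Lambda] of it. *)
Lemma H_ge (R : realType) (N : nat) (mu : 'I_N -> R)
    (alpha beta gamma c lambda : R) :
  let Lambda := \sum_(i < N) mu i in
  (forall i, 0 < mu i) -> 0 < alpha -> 0 <= lambda -> 0 < Lambda ->
  exists K : R, forall q : 'rV[R]_N,
    (1 - lambda / Lambda) * (\sum_(i < N) mu i `^ (1 - beta) * q 0 i) + K
    <= H mu alpha beta gamma c lambda q.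
Proof.
move=> Lambda mu_gt0 alpha_gt0 lambda_ge0 Lambda_gt0.
pose C := \sum_(i < N) mu i `^ (1 - beta).
pose E := \sum_(i < N) mu i * ln (mu i).
exists (lambda / alpha * (ln Lambda + (gamma - 1) * E / Lambda)
        - lambda / Lambda * c * C) => q.
rewrite /H; set S := \sum_(i < N) _ * q 0 i.
pose d i := - alpha * (q 0 i + c) / mu i `^ beta + (gamma - 1) * ln (mu i).
have -> : \sum_(j < N)
      mu j `^ gamma * expR (- alpha * (q 0 j + c) / mu j `^ beta)
    = \sum_j mu j * expR (d j).
  apply: eq_bigr => j _.
  have -> : mu j * expR (d j) = expR (ln (mu j)) * expR (d j).
    by rewrite lnK// posrE.
  have -> : mu j `^ gamma = expR (gamma * ln (mu j)) by rewrite /powR gt_eqF.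
  rewrite -!expRD /d; congr expR; ring.
have Ed : \sum_j mu j * d j = - alpha * (S + c * C) + (gamma - 1) * E.
  rewrite /S /C /E !mulr_sumr -big_split/= !mulr_sumr -big_split/=.
  apply: eq_bigr => j _; have mu_neq0 : mu j != 0 by rewrite gt_eqF.
  rewrite /d powRB ?mu_neq0 ?implybT// powRr1 ?(ltW (mu_gt0 j))//; ring.
have la_ge0 : 0 <= lambda / alpha by rewrite divr_ge0// ltW.
have := ler_wpM2l la_ge0
  (@ln_sum_expR_ge _ _ mu d (fun i => ltW (mu_gt0 i)) Lambda_gt0).
rewrite Ed -/Lambda => le_ln.
apply: le_trans (lerD (lexx S) le_ln).
rewrite le_eqVlt; apply/orP; left; apply/eqP; field.
by rewrite !gt_eqF.
Qed.

Theorem proposition3p5 (R : realType) (N : nat) (mu : 'I_N -> R)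
    (alpha beta gamma c lambda : R)
    (N_ge1 : (1 <= N)%N) (mu_gt0 : forall i, 0 < mu i)
    (alpha_gt0 : 0 < alpha) (beta_gt0 : 0 < beta)
    (c_ge0 : 0 <= c) (lambda_gt0 : 0 < lambda) :
  let Lambda := \sum_(i < N) mu i in
  lambda < Lambda ->
  convex_function (nonneg_orthant R N) (H mu alpha beta gamma c lambda) /\
  coercive_on (nonneg_orthant R N) (H mu alpha beta gamma c lambda).
Proof.
move=> Lambda lt_lambda; split; first by apply: H_convex => //; exact: ltW.
have Lambda_gt0 : 0 < Lambda := lt_trans lambda_gt0 lt_lambda.
have [K leH] := @H_ge _ _ _ alpha beta gamma c lambda mu_gt0 alpha_gt0
  (ltW lambda_gt0) Lambda_gt0.
pose k := 1 - lambda / Lambda.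
(* The hypothesis [lambda < Lambda] gives the lower bound a positive slope. *)
have k_gt0 : 0 < k by rewrite subr_gt0 ltr_pdivrMr// mul1r.
pose p i := mu i `^ (1 - beta).
have p_gt0 i : 0 < p i by rewrite powR_gt0.
pose B := \sum_(i < N) (p i)^-1.
have B_gt0 : 0 < B.
  rewrite /B (bigD1 (Ordinal N_ge1))//= ltr_pwDl ?invr_gt0//.
  by apply: sumr_ge0 => i _; rewrite invr_ge0 ltW.
(* The weighted sum is at least [norm2 q / B], so beyond this radius it exceeds [(A - K) / k], where
   the lower bound [k * _ + K] equals [A]. *)
move=> A; exists ((A - K) / k * B) => q q_ge0 lt_norm.
apply: lt_le_trans (leH q); rewrite -ltrBlDr mulrC -ltr_pdivrMr//.
rewrite -(ltr_pM2r B_gt0); apply: lt_le_trans lt_norm _.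
exact: norm2_le_weighted_sum.
Qed.
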